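(* For each $c\in\{1,2,3\}$ the differential-difference system $$r^1_{1,x}-r^1_x=e^{r^1+r^1_1-r^2_1},\qquad r^2_{1,x}-r^2_x=e^{-cr^1+r^2+r^2_1}$$ for the unknown functions $r^1=r^1(n,x)$, $r^2=r^2(n,x)$ ($n\in\mathbb Z$, $x$ continuous) is Darboux integrable. That is, there are integers $k,s$, two $x$-integrals $F^{(1)},F^{(2)}$ of order $k$ of the form $F^{(i)}=F^{(i)}(x,r,r_1,\dots,r_k)$, and two $n$-integrals $I^{(1)},I^{(2)}$ of order $s$ of the form $I^{(i)}=I^{(i)}(x,r,r_{[1]},\dots,r_{[s]})$, such that $$\det\left(\frac{\partial F^{(i)}}{\partial r^j_k}\right)_{i,j=1,2}\neq0\qquad\text{and}\qquad \det\left(\frac{\partial I^{(i)}}{\partial r^j_{[s]}}\right)_{i,j=1,2}\neq 0 .$$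
   Context: Notation: $r=(r^1,r^2)$; $r^j_k=r^j(n+k,x)$ and $r_k=(r^1_k,r^2_k)$; $r^j_{[i]}=\partial^i r^j(n,x)/\partial x^i$ and $r_{[i]}=(r^1_{[i]},r^2_{[i]})$; $r^j_x=r^j_{[1]}$ and $r^j_{1,x}=\partial_x r^j(n+1,x)$. The independent dynamical variables are the fields $r^1,r^2$, their shifts $r^j_k$ ($k\in\mathbb Z$) and their $x$-derivatives $r^j_{[i]}$ ($i\ge1$); mixed quantities $\partial_x^i r^j_k$ ($k\ne0$, $i\geq 1$) are expressed through the dynamical variables by means of the system and its shifts and derivatives. $D$ is the shift operator $Dh(n)=h(n+1)$, and $D_x$ is the operator of total derivative with respect to $x$; both are computed by virtue of the system. A function $F=F(x,r_{k'},r_{k'+1},\dots,r_k)$ with $k'\le k$ is an $x$-integral of order $k-k'$ if $D_xF=0$. A function $I=I(x,r,r_{[1]},\dots,r_{[s]})$ is an $n$-integral of order $s$ if $DI=I$. *)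

(* Defs.v *)
From HB Require Import structures.
From mathcomp Require Import all_boot all_order all_algebra.
From mathcomp Require Import all_classical all_reals all_analysis.
Set Implicit Arguments.
Unset Strict Implicit.
Unset Printing Implicit Defensive.
Import Order.TTheory GRing.Theory Num.Theory.
Import numFieldNormedType.Exports.
Local Open Scope classical_set_scope.
Local Open Scope ring_scope.

(* The components r^1, r^2 are indexed by 0, 1 : 'I_2.
   Xvar is x, Shv j k is r^j_k, and Drv j i is r^j_[i.+1]: the derivative of
   order 0 is the field itself, i.e. Shv j 0. *)
Inductive dvar : Type :=
  | Xvar
  | Shv of 'I_2 & int
  | Drv of 'I_2 & nat.

Definition dvar_encode (v : dvar) : option ('I_2 * int + 'I_2 * nat) :=
  match v with
  | Xvar => None
  | Shv j k => Some (inl (j, k))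
  | Drv j i => Some (inr (j, i))
  end.

Definition dvar_decode (e : option ('I_2 * int + 'I_2 * nat)) : dvar :=
  match e with
  | None => Xvar
  | Some (inl (j, k)) => Shv j k
  | Some (inr (j, i)) => Drv j i
  end.

Lemma dvar_encodeK : cancel dvar_encode dvar_decode.
Proof. by case. Qed.

HB.instance Definition _ := Choice.copy dvar (can_type dvar_encodeK).

(* r^j_[i] for every i >= 0 *)
Definition fieldDer (j : 'I_2) (i : nat) : dvar :=
  if i is i'.+1 then Drv j i' else Shv j 0.

Section Jets.
Context {R : realType}.

(* A jet assigns a real value to each dynamical variable. *)
Definition jet : Type := dvar -> R.

Definition partial (v : dvar) (h : jet -> R) (u : jet) : R :=
  ((fun t : R => h (dfwith u v t))^`() (u v))%classic.

(* C^m; for a function of finitely many dynamical variables, continuity in the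
   pointwise (product) topology is the usual joint continuity. *)
Fixpoint isC (m : nat) (h : jet -> R) : Prop :=
  continuous (h : {ptws dvar -> R} -> R) /\
  if m is m'.+1 then
    forall v : dvar,
      (forall u : jet, derivable (fun t : R => h (dfwith u v t)) (u v) 1) /\
      isC m' (partial v h)
  else True.

Definition smooth (h : jet -> R) : Prop := forall m : nat, isC m h.

Definition depends_on (A : set dvar) (h : jet -> R) : Prop :=
  forall u w : jet, (forall v, A v -> u v = w v) -> h u = h w.

Section System.
(* Right-hand sides of the system r^j_{1,x} - r^j_x = g^j(r, r_1). *)
Variable g : 'I_2 -> ('I_2 -> R) -> ('I_2 -> R) -> R.

(* D^k g^j, as a function of r_k and r_{k+1} *)
Definition shifted_rhs (j : 'I_2) (k : int) (u : jet) : R :=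
  g j (fun i => u (Shv i k)) (fun i => u (Shv i (k + 1))).

(* D_x of a dynamical variable, expressed through the dynamical variables:
     D_x r^j_k = r^j_x + sum_(0 <= l < k) D^l g^j     for k >= 0,
     D_x r^j_k = r^j_x - sum_(k <= l < 0) D^l g^j     for k < 0
   (recall that Negz m is - (m + 1)). *)
Definition Dx_var (v : dvar) (u : jet) : R :=
  match v with
  | Xvar => 1
  | Shv j (Posz m) => u (Drv j 0) + \sum_(l < m) shifted_rhs j l%:Z u
  | Shv j (Negz m) => u (Drv j 0) - \sum_(l < m.+1) shifted_rhs j (Negz l) u
  | Drv j i => u (Drv j i.+1)
  end.

(* Total derivative, by the chain rule.  The sum over all dynamical variables
   has finite support when h depends on finitely many of them, the only case
   in which this operator is meaningful (and used). *)
Definition Dx (h : jet -> R) (u : jet) : R :=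
  \sum_(v \in [set: dvar]) partial v h u * Dx_var v u.

(* Values at n+1 of the dynamical variables, expressed through their values at
   n; in particular D r^j_[i] is the mixed quantity D_x^i r^j_1. *)
Definition shift_point (u : jet) : jet := fun v =>
  match v with
  | Xvar => u Xvar
  | Shv j k => u (Shv j (k + 1))
  | Drv j i => iter i.+1 Dx (fun w : jet => w (Shv j 1)) u
  end.

Definition Dshift (h : jet -> R) (u : jet) : R := h (shift_point u).

(* F = F(x, r_{k'}, ..., r_k) with k' <= k and D_x F = 0; its order is k - k' *)
Definition x_integral (k' k : int) (F : jet -> R) : Prop :=
  [/\ k' <= k, smooth F,
      depends_on [set v | v = Xvar \/
                    exists (j : 'I_2) (l : int), k' <= l <= k /\ v = Shv j l] F
    & forall u, Dx F u = 0].

(* I = I(x, r, r_[1], ..., r_[s]) with D I = I *)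
Definition n_integral (s : nat) (I : jet -> R) : Prop :=
  [/\ smooth I,
      depends_on [set v | v = Xvar \/
                    exists (j : 'I_2) (i : nat),
                      (i <= s)%N /\ v = fieldDer j i] I
    & forall u, Dshift I u = I u].

Definition Darboux_integrable : Prop :=
  exists (k s : nat) (F I : 'I_2 -> jet -> R),
    [/\ forall i, x_integral 0 k%:Z (F i),
        forall i, n_integral s (I i),
        forall u, \det (\matrix_(i < 2, j < 2) partial (Shv j k%:Z) (F i) u)
                    != 0
      & forall u, \det (\matrix_(i < 2, j < 2) partial (fieldDer j s) (I i) u)
                    != 0].

End System.

(* r^1_{1,x} - r^1_x = exp(r^1 + r^1_1 - r^2_1),
   r^2_{1,x} - r^2_x = exp(- c r^1 + r^2 + r^2_1) *)
Definition exp_rhs (c : nat) (j : 'I_2) (r r1 : 'I_2 -> R) : R :=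
  if j == 0 then expR (r 0 + r1 0 - r1 1)
  else expR (- (c%:R * r 0) + r 1 + r1 1).

End Jets.

(* Main.v *)
Require Import Defs.
From mathcomp Require Import all_boot all_order all_algebra.
From mathcomp Require Import all_classical all_reals all_analysis.
From mathcomp Require Import ring.

(* Write p = r^1_x and q = r^2_x.  The shift (p, q) -> (p + f, q + g), with f
   and g the right-hand sides of the system, is the composition of the moves
   q -> q + g, where g' = g (2 q - c p + g), and p -> p + f, where
   f' = f (2 p - (q + g) + f).  A Riccati computation shows that the first one
   preserves q' - q^2 + c p q and the second one p' - p^2 + p q.  Hence
   T = q' - q^2 + c (p' - p^2 + p q) is an n-integral; a second one is a
   polynomial W in the jets of p and T that is also a polynomial in the jets of
   q and p' - p^2 + p q.

   For the x-integrals, put X_k = exp (r^1_(k+1) - r^1_k) and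
   Y_k = exp (r^2_(k+1) - r^2_k).  Then D_x X_k = X_k f_k, D_x Y_k = Y_k g_k,
   f_(k+1) / f_k = X_k X_(k+1) / Y_(k+1) and
   g_(k+1) / g_k = Y_k Y_(k+1) / X_k^c.  These are the relations of q-characters
   of type A_2 for c = 1, and of the foldings of A_3 and D_4 for c = 2 and
   c = 3: the x-integrals are the (folded) fundamental q-characters, of
   dimensions 3, 3, then 4, 6, then 8, 29. *)

Set Implicit Arguments.
Unset Strict Implicit.
Unset Printing Implicit Defensive.
Import Order.TTheory GRing.Theory Num.Theory.
Import numFieldNormedType.Exports.
Local Open Scope classical_set_scope.
Local Open Scope ring_scope.

(** * Exponential polynomials in the dynamical variables and their derivatives *)

Section ExpPoly.
Context {R : realType}.
Local Notation jet := (@jet R).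
Implicit Types (h k : jet -> R) (u : jet) (v : dvar).

(** A class that contains the right-hand sides and all the integrals and is closed under partial
    derivatives and [Dx]. Inverses are left out: a reciprocal of an exponential enters as the
    exponential of the opposite exponent. *)
Inductive exppoly : (jet -> R) -> Prop :=
  | exppoly_cst a : exppoly (fun=> a)
  | exppoly_var v : exppoly (fun u => u v)
  | exppolyD h k : exppoly h -> exppoly k -> exppoly (fun u => h u + k u)
  | exppolyM h k : exppoly h -> exppoly k -> exppoly (fun u => h u * k u)
  | exppoly_exp h : exppoly h -> exppoly (fun u => expR (h u)).

Lemma exppolyN h : exppoly h -> exppoly (fun u => - h u).
Proof.
move=> eh; rewrite (_ : (fun u => _) = (fun u => -1 * h u)).
  exact/exppolyM/eh/exppoly_cst.
by apply/funext => u; rewrite mulN1r.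
Qed.

Lemma exppolyB h k : exppoly h -> exppoly k -> exppoly (fun u => h u - k u).
Proof. by move=> eh ek; apply: exppolyD => //; exact: exppolyN. Qed.

Lemma exppolyX h n : exppoly h -> exppoly (fun u => h u ^+ n).
Proof.
move=> eh; elim: n => [|n IHn]; first exact: exppoly_cst.
rewrite (_ : (fun u => _) = (fun u => h u * h u ^+ n)); first exact: exppolyM.
by apply/funext => u; rewrite exprS.
Qed.

Lemma exppoly_sum (I : Type) (s : seq I) (F : I -> jet -> R) :
  (forall i, exppoly (F i)) -> exppoly (fun u => \sum_(i <- s) F i u).
Proof.
move=> eF; elim: s => [|i s IHs].
  rewrite (_ : (fun u => _) = (fun=> 0)); first exact: exppoly_cst.
  by apply/funext => u; rewrite big_nil.
rewrite (_ : (fun u => _) = (fun u => F i u + \sum_(j <- s) F j u)).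
  exact: exppolyD.
by apply/funext => u; rewrite big_cons.
Qed.

Lemma dfwith_id u v : dfwith u v (u v) = u.
Proof. by apply/funext => w; case: dfwithP. Qed.

Lemma exppoly_is_derive h v : exppoly h -> exists2 h', exppoly h' &
  forall u, is_derive (u v) 1 (fun t => h (dfwith u v t)) (h' u).
Proof.
elim=> [a|w|{}h k _ [h' eh' dh] _ [k' ek' dk]
  |{}h k eh [h' eh' dh] ek [k' ek' dk]|{}h eh [h' eh' dh]].
- exists (fun=> 0) => [|u]; [exact: exppoly_cst|exact: is_derive_cst].
- exists (fun=> (v == w)%:R) => [|u]; first exact: exppoly_cst.
  have [<-|vw] := eqVneq v w.
    by under eq_fun do rewrite dfwithin; exact: is_derive_id.
  by under eq_fun do rewrite dfwithout//; exact: is_derive_cst.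
- by exists (fun u => h' u + k' u) => [|u]; [exact: exppolyD|exact: is_deriveD].
- exists (fun u => h u * k' u + k u * h' u) => [|u].
    by apply: exppolyD; exact: exppolyM.
  by have := is_deriveM (dh u) (dk u); rewrite !dfwith_id.
- exists (fun u => expR (h u) * h' u) => [|u].
    exact/exppolyM/eh'/exppoly_exp.
  apply: (@is_derive1_comp _ expR (fun t => h (dfwith u v t))) => //.
  by rewrite dfwith_id; exact: is_derive_expR.
Qed.

Lemma partial_is_derive h v u (d : R) :
  is_derive (u v) 1 (fun t => h (dfwith u v t)) d -> partial v h u = d.
Proof. by move=> dh; rewrite /partial derive1E; exact: derive_val. Qed.

Lemma exppoly_derivable h v u :
  exppoly h -> derivable (fun t => h (dfwith u v t)) (u v) 1.
Proof. by move=> /(exppoly_is_derive v)[h' _ /(_ u)[]]. Qed.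

Lemma exppoly_partial h v : exppoly h -> exppoly (partial v h).
Proof.
move=> /(exppoly_is_derive v)[h' eh' dh]; rewrite (_ : partial v h = h') //.
by apply/funext => u; exact: partial_is_derive.
Qed.

Lemma exppoly_partialP h v u : exppoly h ->
  is_derive (u v) 1 (fun t => h (dfwith u v t)) (partial v h u).
Proof.
by move=> /(exppoly_is_derive v)[h' _ dh]; rewrite (partial_is_derive (dh u)).
Qed.

Lemma partial_cst v a u : partial v (fun=> a) u = 0.
Proof. by apply: partial_is_derive; exact: is_derive_cst. Qed.

Lemma partial_var v w u : partial v (fun u => u w) u = (v == w)%:R.
Proof.
apply: partial_is_derive; have [<-|vw] := eqVneq v w.
  by under eq_fun do rewrite dfwithin; exact: is_derive_id.
by under eq_fun do rewrite dfwithout//; exact: is_derive_cst.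
Qed.

Lemma partialD v h k u : exppoly h -> exppoly k ->
  partial v (fun u => h u + k u) u = partial v h u + partial v k u.
Proof.
by move=> eh ek; apply: partial_is_derive; apply: is_deriveD;
  exact: exppoly_partialP.
Qed.

Lemma partialM v h k u : exppoly h -> exppoly k ->
  partial v (fun u => h u * k u) u = partial v h u * k u + h u * partial v k u.
Proof.
move=> eh ek; apply: partial_is_derive.
have := is_deriveM (exppoly_partialP v u eh) (exppoly_partialP v u ek).
by rewrite !dfwith_id addrC [in k u *: _]/GRing.scale/= [in k u * _]mulrC.
Qed.

Lemma partial_expR v h u : exppoly h ->
  partial v (fun u => expR (h u)) u = expR (h u) * partial v h u.
Proof.
move=> eh; apply: partial_is_derive.
apply: (@is_derive1_comp _ expR (fun t => h (dfwith u v t))).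
  by rewrite dfwith_id; exact: is_derive_expR.
exact: exppoly_partialP.
Qed.

Lemma exppoly_continuous h :
  exppoly h -> continuous (h : {ptws dvar -> R} -> R).
Proof.
elim=> [a|w|{}h k _ ch _ ck|{}h k _ ch _ ck|{}h _ ch].
- exact: (@cst_continuous {ptws dvar -> R} R a).
- exact: (@proj_continuous dvar (fun _ => R) w).
- by move=> u; exact: (@continuousD _ _ {ptws dvar -> R} h k u (ch u) (ck u)).
- by move=> u; exact: (@continuousM _ {ptws dvar -> R} h k u (ch u) (ck u)).
- move=> u; apply: (@continuous_comp {ptws dvar -> R} R R h expR u (ch u)).
  exact: continuous_expR.
Qed.

(** The class is stable under [partial], so continuity and derivability of its members propagate to
    every order. *)
Lemma exppoly_smooth h : exppoly h -> smooth h.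
Proof.
move=> eh m; elim: m h eh => [|m IHm] h eh /=; split=> //;
  try exact: exppoly_continuous.
move=> v; split=> [u|]; first exact: exppoly_derivable.
by apply/IHm/exppoly_partial.
Qed.

(** Makes the sum that defines [Dx] finite, with a list that does not depend on the jet. *)
Lemma exppoly_support h : exppoly h ->
  exists s : seq dvar, forall v u, v \notin s -> partial v h u = 0.
Proof.
elim=> [a|w|{}h k eh [s hs] ek [t kt]|{}h k eh [s hs] ek [t kt]|{}h eh [s hs]].
- by exists [::] => v u _; exact: partial_cst.
- by exists [:: w] => v u; rewrite inE partial_var => /negPf ->.
- exists (s ++ t) => v u; rewrite mem_cat negb_or => /andP[vs vt].
  by rewrite partialD// hs// kt// addr0.
- exists (s ++ t) => v u; rewrite mem_cat negb_or => /andP[vs vt].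
  by rewrite partialM// hs// kt// mul0r mulr0 addr0.
- by exists s => v u vs; rewrite partial_expR// hs// mulr0.
Qed.

(** * The total derivative as a derivation of exponential polynomials *)

Section TotalDerivative.
Variable g : 'I_2 -> ('I_2 -> R) -> ('I_2 -> R) -> R.

(** The list may be larger than the support, so that two functions can be differentiated over a
    common list. *)
Lemma Dx_seq h (s : seq dvar) u : uniq s ->
  (forall v, v \notin s -> partial v h u = 0) ->
  Dx g h u = \sum_(v <- s) partial v h u * Dx_var g v u.
Proof.
move=> us hs; rewrite (fsbig_seq _ _ us) /Dx; apply/esym/fsbig_widen => //.
by move=> v /= [_ /negP vs]; rewrite hs ?mul0r.
Qed.

Lemma Dx_cst a u : Dx g (fun=> a) u = 0.
Proof. by rewrite (@Dx_seq _ [::]) ?big_nil// => v _; exact: partial_cst. Qed.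

Lemma Dx_jetvar v u : Dx g (fun u => u v) u = Dx_var g v u.
Proof.
rewrite (@Dx_seq _ [:: v])// ?big_seq1 ?partial_var ?eqxx ?mul1r//.
by move=> w; rewrite inE partial_var => /negPf ->.
Qed.

Lemma Dx_expR h u :
  exppoly h -> Dx g (fun u => expR (h u)) u = expR (h u) * Dx g h u.
Proof.
move=> eh; have [s hs] := exppoly_support eh.
have hs' v : v \notin undup s -> partial v h u = 0.
  by rewrite mem_undup => /hs.
rewrite !(@Dx_seq _ (undup s)) ?undup_uniq//; last first.
  by move=> v vs; rewrite partial_expR// hs'// mulr0.
by rewrite big_distrr; apply: eq_bigr => v _; rewrite partial_expR//= mulrA.
Qed.

Lemma exppoly_support2 h k : exppoly h -> exppoly k ->
  exists s, [/\ uniq s, forall v u, v \notin s -> partial v h u = 0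
                & forall v u, v \notin s -> partial v k u = 0].
Proof.
move=> /exppoly_support[s hs] /exppoly_support[t kt].
by exists (undup (s ++ t)); split=> [|v u|v u]; rewrite ?undup_uniq//
  mem_undup mem_cat negb_or => /andP[vs vt]; [exact: hs|exact: kt].
Qed.

Lemma DxD h k u : exppoly h -> exppoly k ->
  Dx g (fun u => h u + k u) u = Dx g h u + Dx g k u.
Proof.
move=> eh ek; have [s [us hs ks]] := exppoly_support2 eh ek.
rewrite !(@Dx_seq _ s)// -?big_split/=; last 3 first.
- by move=> v /ks.
- by move=> v /hs.
- by move=> v vs; rewrite partialD// hs// ks// addr0.
by apply: eq_bigr => v _; rewrite partialD// mulrDl.
Qed.

Lemma DxM h k u : exppoly h -> exppoly k ->
  Dx g (fun u => h u * k u) u = Dx g h u * k u + h u * Dx g k u.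
Proof.
move=> eh ek; have [s [us hs ks]] := exppoly_support2 eh ek.
rewrite !(@Dx_seq _ s)// ?big_distrr ?big_distrl -?big_split/=; last 3 first.
- by move=> v /ks.
- by move=> v /hs.
- by move=> v vs; rewrite partialM// hs// ks// mul0r mulr0 addr0.
by apply: eq_bigr => v _; rewrite partialM//; ring.
Qed.

Lemma DxN h u : exppoly h -> Dx g (fun u => - h u) u = - Dx g h u.
Proof.
move=> eh; rewrite (_ : (fun u => _) = (fun u => -1 * h u)).
  by rewrite DxM ?Dx_cst//; [ring|exact: exppoly_cst].
by apply/funext => w; rewrite mulN1r.
Qed.

Lemma DxB h k u : exppoly h -> exppoly k ->
  Dx g (fun u => h u - k u) u = Dx g h u - Dx g k u.
Proof. by move=> eh ek; rewrite DxD ?DxN//; exact: exppolyN. Qed.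

Hypothesis eg : forall v, exppoly (Dx_var g v).

Lemma exppoly_Dx h : exppoly h -> exppoly (Dx g h).
Proof.
move=> eh; have [s hs] := exppoly_support eh.
rewrite (_ : Dx g h =
    fun u => \sum_(v <- undup s) partial v h u * Dx_var g v u); last first.
  apply/funext => u; rewrite (@Dx_seq _ (undup s)) ?undup_uniq// => v.
  by rewrite mem_undup => /hs.
apply: exppoly_sum => v; apply: exppolyM => //; exact: exppoly_partial.
Qed.

Lemma exppoly_iterDx n h : exppoly h -> exppoly (iter n (Dx g) h).
Proof. by move=> eh; elim: n => //= n; exact: exppoly_Dx. Qed.

End TotalDerivative.
End ExpPoly.

(** * The differential polynomials T and W, as identities between sequences *)

Section Invariants.
Variable A : comRingType.
Implicit Types (s t p q U : nat -> A).

(* Entry n of the jet (h k, (h k)', (h k)'', ...) of a product, in terms of the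
   jets s of h and t of k. *)
Fixpoint leibniz (n : nat) s t : A :=
  if n is m.+1 then
    leibniz m (fun i => s i.+1) t + leibniz m s (fun i => t i.+1)
  else s 0 * t 0.

Lemma leibniz0 s t : leibniz 0 s t = s 0 * t 0.
Proof. by []. Qed.

Lemma leibniz1 s t : leibniz 1 s t = s 1 * t 0 + s 0 * t 1.
Proof. by []. Qed.

Lemma leibniz2 s t : leibniz 2 s t = s 2 * t 0 + 2 * (s 1 * t 1) + s 0 * t 2.
Proof. by rewrite /=; ring. Qed.

Lemma leibniz3 s t :
  leibniz 3 s t = s 3 * t 0 + 3 * (s 2 * t 1 + s 1 * t 2) + s 0 * t 3.
Proof. by rewrite /=; ring. Qed.

Lemma leibniz4 s t : leibniz 4 s t =
  s 4 * t 0 + 4 * (s 3 * t 1 + s 1 * t 3) + 6 * (s 2 * t 2) + s 0 * t 4.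
Proof. by rewrite /=; ring. Qed.

Definition leibnizE :=
  (leibniz0, leibniz1, leibniz2, leibniz3, leibniz4).

(** When [p] and [q] are the jets of p and q, this is the derivative of order [n] of T. *)
Definition T_seq (c : nat) p q n : A :=
  q n.+1 - leibniz n q q + c%:R * (p n.+1 - leibniz n p p + leibniz n p q).

(* Up to scaling, the only differential polynomial in p and T of weight 3, 4, 6
   (with p of weight 1 and T of weight 2), modulo polynomials in T, that is
   preserved by the move p -> p + f. *)
Definition W_pol (c : nat) p (T : nat -> A) : A :=
  match c with
  | 1 => p 2 + T 0 * p 0 - 3 * (p 0 * p 1) + p 0 ^+ 3
  | 2 => p 3 + T 0 * p 1 - 3 * p 1 ^+ 2 + T 1 * p 0 - 4 * (p 0 * p 2)
         - T 0 * p 0 ^+ 2 + 6 * (p 0 ^+ 2 * p 1) - p 0 ^+ 4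
  | _ => 2 * p 5 + 4 * (T 0 * p 3) + 6 * (T 1 * p 2) - 19 * p 2 ^+ 2
         + 6 * (T 2 * p 1) + 2 * (T 0 ^+ 2 * p 1) - 32 * (p 1 * p 3)
         - 14 * (T 0 * p 1 ^+ 2) + 36 * p 1 ^+ 3 + 2 * (T 3 * p 0)
         + 2 * (T 0 * T 1 * p 0) - 10 * (p 0 * p 4) - 12 * (T 0 * p 0 * p 2)
         - 16 * (T 1 * p 0 * p 1) + 102 * (p 0 * p 1 * p 2)
         - 4 * (T 2 * p 0 ^+ 2) - T 0 ^+ 2 * p 0 ^+ 2 + 22 * (p 0 ^+ 2 * p 3)
         + 16 * (T 0 * p 0 ^+ 2 * p 1) - 69 * (p 0 ^+ 2 * p 1 ^+ 2)
         + 4 * (T 1 * p 0 ^+ 3) - 26 * (p 0 ^+ 3 * p 2) - 2 * (T 0 * p 0 ^+ 4)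
         + 18 * (p 0 ^+ 4 * p 1) - p 0 ^+ 6
  end.

(* The recurrence expresses [p 1, p 2, ...] through [p 0], and all occurrences
   of [p 0] cancel. *)
Lemma W_pol_indep c p p' q U : c \in [:: 1; 2; 3]%N ->
  (forall n, p n.+1 = U n + leibniz n p p - leibniz n p q) ->
  (forall n, p' n.+1 = U n + leibniz n p' p' - leibniz n p' q) ->
  let T n := q n.+1 - leibniz n q q + c%:R * U n in
  W_pol c p' T = W_pol c p T.
Proof.
move=> hc pE p'E T; rewrite !inE in hc.
(* The Riccati equation r' = U + r^2 - r q and its first four derivatives; [p 5] is the highest
   entry that occurs in [W_pol]. *)
have jet_rec (r : nat -> A) :
    (forall n, r n.+1 = U n + leibniz n r r - leibniz n r q) ->
  [/\ r 1 = U 0 + r 0 ^+ 2 - r 0 * q 0,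
      r 2 = U 1 + 2 * (r 0 * r 1) - (r 1 * q 0 + r 0 * q 1),
      r 3 = U 2 + 2 * (r 0 * r 2 + r 1 ^+ 2)
            - (r 2 * q 0 + 2 * (r 1 * q 1) + r 0 * q 2),
      r 4 = U 3 + 2 * (r 0 * r 3) + 6 * (r 1 * r 2)
            - (r 3 * q 0 + 3 * (r 2 * q 1 + r 1 * q 2) + r 0 * q 3)
    & r 5 = U 4 + 2 * (r 0 * r 4) + 8 * (r 1 * r 3) + 6 * r 2 ^+ 2
            - (r 4 * q 0 + 4 * (r 3 * q 1 + r 1 * q 3) + 6 * (r 2 * q 2)
               + r 0 * q 4)].
  by move=> rE; split; rewrite rE !leibnizE; ring.
have [p1 p2 p3 p4 p5] := jet_rec _ pE.
have [p'1 p'2 p'3 p'4 p'5] := jet_rec _ p'E.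
(* Higher entries are eliminated first, since their expressions contain the lower ones. *)
case/or3P: hc => /eqP c_eq; rewrite /T c_eq /W_pol !leibnizE.
- by rewrite p2 p1 p'2 p'1; ring.
- by rewrite p3 p2 p1 p'3 p'2 p'1; ring.
- by rewrite p5 p4 p3 p2 p1 p'5 p'4 p'3 p'2 p'1; ring.
Qed.
End Invariants.

(** * Invariance of T and W under the two moves of the shift *)

Section InvariantsTheory.
Variable A : comRingType.
Implicit Types (s t p q : nat -> A).

Lemma eq_leibniz n s s' t t' : (forall i, (i <= n)%N -> s i = s' i) ->
  (forall i, (i <= n)%N -> t i = t' i) -> leibniz n s t = leibniz n s' t'.
Proof.
elim: n s s' t t' => [|n IHn] s s' t t' ss' tt' /=; first by rewrite ss' ?tt'.
by congr (_ + _); apply: IHn => i lin; rewrite ?ss' ?tt'// ltnW.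
Qed.

Lemma leibnizC n s t : leibniz n s t = leibniz n t s.
Proof.
elim: n s t => [|n IHn] s t /=; first by rewrite mulrC.
by rewrite IHn [leibniz n s _]IHn addrC.
Qed.

Lemma leibnizZr n a s t : leibniz n s (fun i => a * t i) = a * leibniz n s t.
Proof.
by elim: n s t => [|n IHn] s t /=; [exact: mulrCA|rewrite !IHn mulrDr].
Qed.

Section Shift.
Variables (c : nat) (p q p' q' : nat -> A).

(* The shift (p, q) -> (p', q') is the composition of (p, q) -> (p, q') and
   (p, q') -> (p', q'), which preserve a Riccati expression in q, resp. p. *)
Hypothesis qE : forall n,
  q' n.+1 - leibniz n q' q' + leibniz n q' (fun i => c%:R * p i)
  = q n.+1 - leibniz n q q + leibniz n q (fun i => c%:R * p i).
Hypothesis pE : forall n,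
  p' n.+1 - leibniz n p' p' + leibniz n p' q'
  = p n.+1 - leibniz n p p + leibniz n p q'.

(** T is (q' - q^2 + c p q) + c (p' - p^2), where primes denote derivatives: the first move
    preserves the first bracket and fixes p. *)
Lemma T_seq_mid n : T_seq c p q' n = T_seq c p q n.
Proof.
have := qE n; rewrite !leibnizZr /T_seq => qn.
have -> : q' n.+1 = q' n.+1 - leibniz n q' q' + c%:R * leibniz n q' p
    + (leibniz n q' q' - c%:R * leibniz n q' p) by ring.
by rewrite qn (leibnizC n q' p) (leibnizC n q p); ring.
Qed.

Lemma T_seq_shift n : T_seq c p' q' n = T_seq c p q n.
Proof. by rewrite -T_seq_mid /T_seq pE. Qed.

(** The first move fixes p and T, hence W. In the second one, the old and the new p solve the same
    Riccati recurrence, so [W_pol_indep] applies. *)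
Lemma W_pol_shift : c \in [:: 1; 2; 3]%N ->
  W_pol c p' (T_seq c p' q') = W_pol c p (T_seq c p q).
Proof.
move=> hc; have [Tp' Tp] : T_seq c p' q' =1 T_seq c p q' /\
    T_seq c p q' =1 T_seq c p q.
  by split=> n; rewrite ?T_seq_shift T_seq_mid.
have W_ext (r T1 T2 : nat -> A) : T1 =1 T2 -> W_pol c r T1 = W_pol c r T2.
  by move=> T12; rewrite /W_pol !T12.
rewrite (W_ext _ _ _ Tp') -(W_ext _ _ _ Tp).
(* With this choice, [T_seq c p q'] is by conversion the sequence [T] of [W_pol_indep]. *)
pose U n := p n.+1 - leibniz n p p + leibniz n p q'.
apply: (W_pol_indep hc (q := q') (U := U)) => n; rewrite /U; first by ring.
by rewrite -pE; ring.
Qed.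

End Shift.
End InvariantsTheory.

(** * Iterated total derivatives of products and Riccati expressions *)

Section IteratedTotalDerivative.
Context {R : realType}.
Local Notation jet := (@jet R).
Implicit Types (h k : jet -> R) (u : jet).
Variable g : 'I_2 -> ('I_2 -> R) -> ('I_2 -> R) -> R.
Hypothesis eg : forall v, exppoly (Dx_var g v).

Lemma iterDxD n h k u : exppoly h -> exppoly k ->
  iter n (Dx g) (fun u => h u + k u) u = iter n (Dx g) h u + iter n (Dx g) k u.
Proof.
move=> eh ek; elim: n u => // n IHn u; rewrite !iterS.
rewrite (_ : iter _ _ _ = fun w => iter n (Dx g) h w + iter n (Dx g) k w).
  by rewrite DxD//; exact: exppoly_iterDx.
exact/funext.
Qed.

Lemma iterDxM n h k u : exppoly h -> exppoly k ->
  iter n (Dx g) (fun u => h u * k u) u =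
  leibniz n (fun i => iter i (Dx g) h u) (fun i => iter i (Dx g) k u).
Proof.
elim: n h k => // n IHn h k eh ek.
have edh := exppoly_Dx eg eh; have edk := exppoly_Dx eg ek.
rewrite iterSr.
rewrite (_ : Dx g _ = fun u => Dx g h u * k u + h u * Dx g k u); last first.
  by apply/funext => w; exact: DxM.
rewrite iterDxD; [|exact: exppolyM..].
by rewrite !IHn//=; congr (_ + _); congr leibniz; apply/funext => i;
  rewrite -iterSr.
Qed.

Lemma iterDxZ n a h u : exppoly h ->
  iter n (Dx g) (fun u => a * h u) u = a * iter n (Dx g) h u.
Proof.
move=> eh; elim: n u => // n IHn u; rewrite !iterS.
rewrite (_ : iter _ _ _ = fun w => a * iter n (Dx g) h w); last exact/funext.
rewrite DxM ?Dx_cst ?mul0r ?add0r//; first exact: exppoly_cst.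
exact: exppoly_iterDx.
Qed.

(** Turns one equality between Riccati expressions into the whole family of differentiated
    equalities assumed in section [Shift]. *)
Lemma iterDx_riccati n h k u : exppoly h -> exppoly k ->
  let s i := iter i (Dx g) h u in let t i := iter i (Dx g) k u in
  iter n (Dx g) (fun u => Dx g h u - h u * h u + h u * k u) u =
  s n.+1 - leibniz n s s + leibniz n s t.
Proof.
move=> eh ek s t; have edh := exppoly_Dx eg eh.
have ehh := exppolyM eh eh; have ehk := exppolyM eh ek.
rewrite iterDxD; [|exact: exppolyB|by []].
rewrite iterDxD//; last exact: exppolyN.
rewrite (_ : (fun u => - _) = (fun u => -1 * (h u * h u))); last first.
  by apply/funext => w; rewrite mulN1r.
by rewrite iterDxZ// !iterDxM// -iterSr mulN1r.
Qed.

End IteratedTotalDerivative.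

(** * The exponential system and the action of the shift on x-derivatives *)

Section System.
Context {R : realType}.
Variable c : nat.
Local Notation jet := (@jet R).
Implicit Types (u : jet).
Local Notation g := (@exp_rhs R c).

Lemma shifted_rhs0 (k : int) u : shifted_rhs g 0 k u =
  expR (u (Shv 0 k) + u (Shv 0 (k + 1)) - u (Shv 1 (k + 1))).
Proof. by []. Qed.

Lemma shifted_rhs1 (k : int) u : shifted_rhs g 1 k u =
  expR (- (c%:R * u (Shv 0 k)) + u (Shv 1 k) + u (Shv 1 (k + 1))).
Proof. by []. Qed.

Lemma ord2P (P : 'I_2 -> Prop) : P 0 -> P 1 -> forall j, P j.
Proof.
by move=> P0 P1 [[|[|//]] j2]; [move: P0|move: P1]; congr P; apply: val_inj.
Qed.

Lemma exppoly_rhs j k : exppoly (shifted_rhs g j k).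
Proof.
elim/ord2P: j; apply: exppoly_exp.
  by apply: exppolyB; [apply: exppolyD|]; exact: exppoly_var.
apply: exppolyD; last exact: exppoly_var.
apply: exppolyD; last exact: exppoly_var.
by apply/exppolyN/exppolyM; [exact: exppoly_cst|exact: exppoly_var].
Qed.

Lemma exppoly_Dx_var v : exppoly (Dx_var g v).
Proof.
case: v => [|j [m|m]|j i].
- exact: exppoly_cst.
- apply: exppolyD; first exact: exppoly_var.
  by apply: exppoly_sum => i; exact: exppoly_rhs.
- apply: exppolyB; first exact: exppoly_var.
  by apply: exppoly_sum => i; exact: exppoly_rhs.
- exact: exppoly_var.
Qed.

Lemma Dx_shift1 j :
  Dx g (fun u => u (Shv j 1)) = fun u => u (Drv j 0) + shifted_rhs g j 0 u.
Proof. by apply/funext => u; rewrite Dx_jetvar /= big_ord1. Qed.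

Lemma iterDx_Drv j n u : iter n (Dx g) (fun u => u (Drv j 0)) u = u (Drv j n).
Proof.
elim: n u => // n IHn u; rewrite iterS (_ : iter _ _ _ = fun w => w (Drv j n)).
  by rewrite Dx_jetvar.
exact/funext.
Qed.

(** The second factor is the derivative of the exponent, p + (p + f) - (q + g). It involves the
    shifted q, which is why the move of q comes first. *)
Lemma Dx_rhs0 u : Dx g (shifted_rhs g 0 0) u = shifted_rhs g 0 0 u *
  (2 * u (Drv 0 0) - u (Drv 1 0) + shifted_rhs g 0 0 u - shifted_rhs g 1 0 u).
Proof.
rewrite [X in Dx _ X _](_ : _ =
  fun u => expR (u (Shv 0 0) + u (Shv 0 1) - u (Shv 1 1)))//.
have ev := @exppoly_var R.
rewrite Dx_expR; last by apply: exppolyB => //; exact: exppolyD.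
rewrite DxB//; last exact: exppolyD.
rewrite DxD// !Dx_shift1 Dx_jetvar /= big_ord0.
congr (_ * _); ring.
Qed.

Lemma Dx_rhs1 u : Dx g (shifted_rhs g 1 0) u = shifted_rhs g 1 0 u *
  (2 * u (Drv 1 0) - c%:R * u (Drv 0 0) + shifted_rhs g 1 0 u).
Proof.
rewrite [X in Dx _ X _](_ : _ =
  fun u => expR (- (c%:R * u (Shv 0 0)) + u (Shv 1 0) + u (Shv 1 1)))//.
have ev := @exppoly_var R.
have ecv : exppoly (fun u : jet => c%:R * u (Shv 0 0)).
  by apply: exppolyM => //; exact: exppoly_cst.
have encv := exppolyN ecv.
rewrite Dx_expR; last by apply: exppolyD => //; exact: exppolyD.
rewrite DxD//; last exact: exppolyD.
rewrite DxD// DxN// DxM//; last exact: exppoly_cst.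
rewrite Dx_cst !Dx_shift1 !Dx_jetvar /= !big_ord0.
congr (_ * _); ring.
Qed.

(** Replacing s by s + h in s' - s^2 + s k adds h' - h (2 s - k + h). This vanishes for s = q, h =
    g, k = c p by [Dx_rhs1], and for s = p, h = f, k = q + g by [Dx_rhs0]. *)
Lemma shift_jet_riccati u :
  let p n := u (Drv 0 n) in let q n := u (Drv 1 n) in
  let p' n := shift_point g u (Drv 0 n) in
  let q' n := shift_point g u (Drv 1 n) in
  (forall n, q' n.+1 - leibniz n q' q' + leibniz n q' (fun i => c%:R * p i)
    = q n.+1 - leibniz n q q + leibniz n q (fun i => c%:R * p i)) /\
  (forall n, p' n.+1 - leibniz n p' p' + leibniz n p' q'
    = p n.+1 - leibniz n p p + leibniz n p q').
Proof.
move=> p q p' q'; pose P u := u (Drv 0 0) + shifted_rhs g 0 0 u.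
pose Q u := u (Drv 1 0) + shifted_rhs g 1 0 u.
have eg := exppoly_Dx_var.
have ev := @exppoly_var R.
have eP : exppoly P by apply: exppolyD => //; exact: exppoly_rhs.
have eQ : exppoly Q by apply: exppolyD => //; exact: exppoly_rhs.
have ec : exppoly (fun u : jet => c%:R * u (Drv 0 0)).
  by apply: exppolyM => //; exact: exppoly_cst.
(* [Drv 0 i] has order [i.+1]; one of these derivatives is spent in turning r^1_1 into [P]. *)
have p'E : p' = fun i => iter i (Dx g) P u.
  by apply/funext => i; rewrite /p' /shift_point iterSr Dx_shift1.
have q'E : q' = fun i => iter i (Dx g) Q u.
  by apply/funext => i; rewrite /q' /shift_point iterSr Dx_shift1.
have pE : p = fun i => iter i (Dx g) (fun u => u (Drv 0 0)) u.
  by apply/funext => i; rewrite iterDx_Drv.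
have qE : q = fun i => iter i (Dx g) (fun u => u (Drv 1 0)) u.
  by apply/funext => i; rewrite iterDx_Drv.
have cpE : (fun i => c%:R * p i) =
    fun i => iter i (Dx g) (fun u => c%:R * u (Drv 0 0)) u.
  by apply/funext => i; rewrite iterDxZ// iterDx_Drv.
split=> n.
  rewrite cpE q'E qE -[LHS](iterDx_riccati eg n u eQ ec).
  rewrite -[RHS](iterDx_riccati eg n u (ev (Drv 1 0)) ec).
  congr (iter n (Dx g) _ u); apply/funext => w.
  rewrite DxD//; last exact: exppoly_rhs.
  by rewrite Dx_rhs1 /Q; ring.
rewrite p'E q'E pE -[LHS](iterDx_riccati eg n u eP eQ).
rewrite -[RHS](iterDx_riccati eg n u (ev (Drv 0 0)) eQ).
congr (iter n (Dx g) _ u); apply/funext => w.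
rewrite DxD//; last exact: exppoly_rhs.
by rewrite Dx_rhs0 /P /Q; ring.
Qed.

End System.

(** * The n-integrals as functions on jets *)

Section NIntegrals.
Context {R : realType}.
Local Notation jet := (@jet R).
Implicit Types (u : jet).

(** The n-integrals are affine in their derivatives of highest order, so their Jacobian is read off
    from coefficients. *)
Lemma partial_affine (h : jet -> R) v u a :
  (forall t, h (dfwith u v t) = h u + a * (t - u v)) -> partial v h u = a.
Proof.
move=> hE; apply: partial_is_derive; rewrite (funext hE).
have d1 : is_derive (u v) 1 (id - cst (u v)) (1 - 0 : R).
  exact: is_deriveB.
have := is_deriveD (is_derive_cst (h u) (u v) 1) (is_deriveZ a d1).
by rewrite add0r subr0 /GRing.scale /= mulr1.
Qed.

Definition nint (c : nat) (n : nat) (i : 'I_2) u : R :=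
  let p m := u (Drv 0 m) in let q m := u (Drv 1 m) in
  if i == 0 then T_seq c p q n else W_pol c p (T_seq c p q).

Lemma exppoly_leibniz n (s t : nat -> jet -> R) :
  (forall i, exppoly (s i)) -> (forall i, exppoly (t i)) ->
  exppoly (fun u => leibniz n (fun i => s i u) (fun i => t i u)).
Proof.
elim: n s t => [|n IHn] s t es et; first exact: exppolyM.
apply: exppolyD; first exact: (IHn (fun i => s i.+1)).
exact: (IHn s (fun i => t i.+1)).
Qed.

Lemma exppoly_T_seq c n :
  exppoly (fun u : jet =>
    T_seq c (fun m => u (Drv 0 m)) (fun m => u (Drv 1 m)) n).
Proof.
have ev := @exppoly_var R.
have el j k :=
  exppoly_leibniz n (fun m => ev (Drv j m)) (fun m => ev (Drv k m)).
apply: exppolyD; first exact: exppolyB.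
by apply: exppolyM; [exact: exppoly_cst|apply/exppolyD/el/exppolyB/el].
Qed.

Lemma exppoly_nint c n i : exppoly (nint c n i).
Proof.
have ev := @exppoly_var R; have ec := @exppoly_cst R.
elim/ord2P: i; first exact: exppoly_T_seq.
rewrite /nint /= /W_pol; case: c => [|[|[|c]]];
  repeat first [exact: exppoly_T_seq | exact: ev | exact: ec
    | apply: exppolyB | apply: exppolyD | apply: exppolyX | apply: exppolyM].
Qed.
End NIntegrals.

(** * Order, invariance and independence of the n-integrals *)

Section NIntegralsTheory.
Context {R : realType}.
Local Notation jet := (@jet R).
Implicit Types (u : jet).

(* T is differentiated [T_order c] times to reach the order of W. *)
Definition T_order (c : nat) : nat := if c == 3 then 4 else c.

Lemma eq_T_seq c n (p q p' q' : nat -> R) :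
  (forall m, (m <= n.+1)%N -> p m = p' m) ->
  (forall m, (m <= n.+1)%N -> q m = q' m) ->
  T_seq c p q n = T_seq c p' q' n.
Proof.
move=> pp' qq'; have le_n m : (m <= n -> m <= n.+1)%N by exact: leqW.
rewrite /T_seq pp'// qq'// (@eq_leibniz _ n q q' q q')//; last 2 first.
  by move=> m /le_n/qq'.
  by move=> m /le_n/qq'.
by rewrite (@eq_leibniz _ n p p' p p') ?(@eq_leibniz _ n p p' q q')//;
  move=> m /le_n; [exact: pp'|exact: qq'|exact: pp'..].
Qed.

Lemma eq_nint c i u w : c \in [:: 1; 2; 3]%N ->
  (forall j m, (m <= (T_order c).+1)%N -> u (Drv j m) = w (Drv j m)) ->
  nint c (T_order c) i u = nint c (T_order c) i w.
Proof.
move=> hc uw; elim/ord2P: i; first by apply: eq_T_seq => m; exact: uw.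
have TE m : (m <= T_order c)%N ->
    T_seq c (fun m => u (Drv 0 m)) (fun m => u (Drv 1 m)) m =
    T_seq c (fun m => w (Drv 0 m)) (fun m => w (Drv 1 m)) m.
  by move=> mc; apply: eq_T_seq => i im; apply: uw; exact: leq_trans im _.
move: hc uw TE; rewrite !inE => /or3P[] /eqP -> uw TE; rewrite /nint /= !TE//;
  by rewrite !uw.
Qed.

Lemma nint_integral c i : c \in [:: 1; 2; 3]%N ->
  n_integral (@exp_rhs R c) (T_order c).+2 (nint c (T_order c) i).
Proof.
move=> hc; split=> [|u w uw|u]; first exact/exppoly_smooth/exppoly_nint.
  by apply: eq_nint => // j m mc; apply: uw; right; exists j, m.+1.
have [qE pE] := shift_jet_riccati c u.
rewrite /Dshift /nint; case: ifP => _; first exact: T_seq_shift.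
exact: W_pol_shift.
Qed.

Lemma det2 (A : 'M[R]_2) : \det A = A 0 0 * A 1 1 - A 0 1 * A 1 0.
Proof.
rewrite (expand_det_row _ 0) !big_ord_recl big_ord0 addr0 /cofactor !det_mx11.
rewrite !mxE /= expr0 mul1r expr1 mulN1r mulrN.
by congr (A _ _ * A _ _ - A _ _ * A _ _); apply: val_inj.
Qed.

Lemma dfwith_Drv u j m t : forall k n, dfwith u (Drv j m) t (Drv k n) =
  if (j == k) && (m == n) then t else u (Drv k n).
Proof.
move=> k n; case: ifPn => [/andP[/eqP <- /eqP <-]|]; first exact: dfwithin.
rewrite negb_and => jm; rewrite dfwithout//.
by apply/eqP => -[jk mn]; move: jm; rewrite jk mn !eqxx.
Qed.

(** The quadratic terms only involve entries of index at most [n], so entry [n.+1] occurs only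
    linearly. *)
Lemma partial_T_seq c n j u :
  partial (Drv j n.+1) (nint c n 0) u = if j == 0 then c%:R else 1.
Proof.
apply: partial_affine => t; rewrite /nint /T_seq /=.
have L i k (s : jet) : leibniz n (fun m => dfwith u (Drv j n.+1) t (Drv i m))
      (fun m => dfwith u (Drv j n.+1) t (Drv k m)) =
    leibniz n (fun m => u (Drv i m)) (fun m => u (Drv k m)).
  apply: eq_leibniz => m; rewrite -ltnS dfwith_Drv => /gtn_eqF ->;
  by rewrite andbF.
rewrite !L//; elim/ord2P: j L => L; rewrite !dfwith_Drv !eqxx /=; ring.
Qed.

(** The leading coefficient of [W_pol]; it is 2 for c = 3, where W is scaled to have integer
    coefficients. *)
Definition W_lead (c : nat) : R := if c == 3 then 2 else 1.

Lemma partial_W_pol c j u : c \in [:: 1; 2; 3]%N ->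
  partial (Drv j (T_order c).+1) (nint c (T_order c) 1) u =
    if j == 0 then W_lead c else 0.
Proof.
move=> hc; apply: partial_affine => t; rewrite /nint /=.
set p' := fun m => dfwith u _ t (Drv 0 m).
set q' := fun m => dfwith u _ t (Drv 1 m).
(* W only uses these derivatives of T, in which the varied entry does not occur; hence W does not
   see the highest derivative of q. *)
have TE m : (m < T_order c)%N -> T_seq c p' q' m =
    T_seq c (fun m => u (Drv 0 m)) (fun m => u (Drv 1 m)) m.
  rewrite -ltnS => mc; apply: eq_T_seq => i im; rewrite /p' /q' dfwith_Drv;
  by rewrite (gtn_eqF (leq_ltn_trans im mc)) andbF.
move: hc; rewrite !inE => /or3P[] /eqP c_eq; subst c;
  rewrite /W_pol !TE// /p' {p' q' TE}; elim/ord2P: j;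
  rewrite !dfwith_Drv /W_lead/= /T_order/=; ring.
Qed.

Lemma det_nint c u : c \in [:: 1; 2; 3]%N ->
  \det (\matrix_(i < 2, j < 2)
    partial (fieldDer j (T_order c).+2) (nint c (T_order c) i) u) != 0.
Proof.
move=> hc; rewrite det2 !mxE /= !partial_T_seq !partial_W_pol//=.
(* The matrix has rows (c, 1) and ([W_lead c], 0). *)
rewrite mulr0 mul1r sub0r oppr_eq0 /W_lead.
by case: ifP => _; rewrite ?oner_eq0 ?pnatr_eq0.
Qed.

End NIntegralsTheory.

(** * The x-integrals as Laurent polynomials in ratios of exponentials *)

Section XIntegrals.
Context {R : realType}.
Variable c : nat.
Local Notation jet := (@jet R).
Implicit Types (h : jet -> R) (k : nat) (u : jet).
Local Notation g := (@exp_rhs R c).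

(** [ratio 0 k] is X_k and [ratio 1 k] is Y_k. *)
Definition ratio (j : 'I_2) (k : nat) u : R :=
  expR (u (Shv j k.+1) - u (Shv j k)).

Lemma ratio_neq0 j k u : ratio j k u != 0.
Proof. exact: lt0r_neq0 (expR_gt0 _). Qed.

Lemma rhs0_nat (k : nat) u : shifted_rhs g 0 k u =
  expR (u (Shv 0 k) + u (Shv 0 k.+1) - u (Shv 1 k.+1)).
Proof. by rewrite shifted_rhs0 -PoszD addn1. Qed.

Lemma rhs1_nat (k : nat) u : shifted_rhs g 1 k u =
  expR (- (c%:R * u (Shv 0 k)) + u (Shv 1 k) + u (Shv 1 k.+1)).
Proof. by rewrite shifted_rhs1 -PoszD addn1. Qed.

Lemma rhs0_rec (k : nat) u : shifted_rhs g 0 k.+1 u =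
  shifted_rhs g 0 k u * ratio 0 k u * ratio 0 k.+1 u / ratio 1 k.+1 u.
Proof.
by rewrite !rhs0_nat /ratio -expRN -!expRD; congr expR; ring.
Qed.

Lemma rhs1_rec (k : nat) u : shifted_rhs g 1 k.+1 u =
  shifted_rhs g 1 k u * ratio 1 k u * ratio 1 k.+1 u / ratio 0 k u ^+ c.
Proof.
by rewrite !rhs1_nat /ratio -expRM_natl -expRN -!expRD; congr expR; ring.
Qed.

(** A judgment in which [h'] can be left as an existential variable: applying the rules below
    synthesizes the derivative. *)
Definition is_Dx h h' := exppoly h /\ Dx g h =1 h'.

Lemma is_Dx_cst a : is_Dx (fun=> a) (fun=> 0).
Proof. by split=> [|u]; [exact: exppoly_cst|exact: Dx_cst]. Qed.

Lemma is_DxD h (k : jet -> R) h' (k' : jet -> R) : is_Dx h h' -> is_Dx k k' ->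
  is_Dx (fun u => h u + k u) (fun u => h' u + k' u).
Proof.
by move=> [eh hE] [ek kE]; split=> [|u]; [exact: exppolyD|rewrite DxD// hE kE].
Qed.

Lemma is_DxM h (k : jet -> R) h' (k' : jet -> R) : is_Dx h h' -> is_Dx k k' ->
  is_Dx (fun u => h u * k u) (fun u => h' u * k u + h u * k' u).
Proof.
by move=> [eh hE] [ek kE]; split=> [|u]; [exact: exppolyM|rewrite DxM// hE kE].
Qed.

Lemma is_DxX h h' n : is_Dx h h' ->
  is_Dx (fun u => h u ^+ n.+1) (fun u => n.+1%:R * h u ^+ n * h' u).
Proof.
move=> [eh hE]; elim: n => [|n [eX XE]].
  by split=> [|u]; [exact: eh|rewrite mul1r mul1r -hE].
split=> [|u]; first exact: exppolyX.
rewrite (_ : (fun u => _) = fun u => h u * h u ^+ n.+1); last first.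
  by apply/funext => w; rewrite exprS.
by rewrite DxM// hE XE -[n.+2%:R]natr1 [h u ^+ n.+1]exprS; ring.
Qed.

Lemma is_Dx_ratio j (k : nat) :
  is_Dx (ratio j k) (fun u => ratio j k u * shifted_rhs g j k u).
Proof.
have ev := @exppoly_var R.
split=> [|u]; first by apply: exppoly_exp; exact: exppolyB.
rewrite Dx_expR ?DxB//; last exact: exppolyB.
by rewrite !Dx_jetvar /= big_ord_recr /=; congr (_ * _); ring.
Qed.

Lemma is_Dx_ratioV j (k : nat) : is_Dx (fun u => (ratio j k u)^-1)
  (fun u => - ((ratio j k u)^-1 * shifted_rhs g j k u)).
Proof.
have ev := @exppoly_var R.
rewrite (_ : (fun u => (ratio j k u)^-1) =
    fun u => expR (- (u (Shv j k.+1) - u (Shv j k)))); last first.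
  by apply/funext => u; rewrite expRN.
have eB : exppoly (fun u : jet => u (Shv j k.+1) - u (Shv j k)).
  exact: exppolyB.
have eN := exppolyN eB.
split=> [|u]; first exact: exppoly_exp.
rewrite Dx_expR ?DxN ?DxB//.
by rewrite !Dx_jetvar /= big_ord_recr /= /ratio -expRN; ring.
Qed.

(* For c = 1 the first integral is shifted once, so that its order is that of
   the second one. *)
Definition xint_pol (c : nat) (i : 'I_2) (x y : nat -> R) : R :=
  if i == 0 then
    match c with
    | 1 => y 1 + x 1 * (y 2)^-1 + (x 2)^-1
    | 2 => x 0 + y 1 * (x 1)^-1 + x 1 * (y 2)^-1 + (x 2)^-1
    | _ => x 0 + y 1 * (x 1)^-1 + x 1 ^+ 2 * (y 2)^-1 + 2 * (x 1 * (x 2)^-1)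
           + y 2 * (x 2)^-1 ^+ 2 + x 2 * (y 3)^-1 + (x 3)^-1
    end
  else
    match c with
    | 1 => x 0 + y 1 * (x 1)^-1 + (y 2)^-1
    | 2 => y 0 + x 0 ^+ 2 * (y 1)^-1 + 2 * (x 0 * (x 1)^-1)
           + y 1 * (x 1)^-1 ^+ 2 + (y 2)^-1
    | _ => y 0 + x 0 ^+ 3 * (y 1)^-1 + 3 * (x 0 ^+ 2 * (x 1)^-1)
           + 3 * (x 0 * y 1 * (x 1)^-1 ^+ 2) + 3 * (x 0 * x 1 * (y 2)^-1)
           + y 1 ^+ 2 * (x 1)^-1 ^+ 3 + 2 * (y 1 * (y 2)^-1)
           + 3 * (x 0 * (x 2)^-1) + x 1 ^+ 3 * (y 2)^-1 ^+ 2
           + 3 * (y 1 * (x 1)^-1 * (x 2)^-1)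
           + 3 * (x 1 ^+ 2 * (x 2)^-1 * (y 2)^-1) + 3 * (x 1 * (x 2)^-1 ^+ 2)
           + y 2 * (x 2)^-1 ^+ 3 + (y 3)^-1
    end.

Definition xint (i : 'I_2) u : R :=
  xint_pol c i (fun k => ratio 0 k u) (fun k => ratio 1 k u).

Lemma is_Dx_xint i : c \in [:: 1; 2; 3]%N -> is_Dx (xint i) (fun=> 0).
Proof.
have E h h' h'' : is_Dx h h' -> h' =1 h'' -> is_Dx h h''.
  by move=> [eh hE] h'E; split=> // u; rewrite hE.
have r0 j k u := ratio_neq0 j k u.
rewrite !inE => /or3P[] /eqP c_eq; elim/ord2P: i;
  rewrite /xint /xint_pol /= c_eq;
  (eapply E; [repeat first [eapply is_Dx_cst | eapply is_Dx_ratioV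
    | eapply is_Dx_ratio | eapply is_DxX | eapply is_DxD | eapply is_DxM] | ]);
  (* The recurrences reduce every f_k and g_k to f_0 and g_0, leaving an identity of rational
     functions in the ratios. *)
  move=> u /=; rewrite !(rhs0_rec, rhs1_rec) c_eq; field; by rewrite ?r0.
Qed.

Definition x_order : nat := if c == 3 then 4 else 3.

Lemma eq_xint i u w : c \in [:: 1; 2; 3]%N ->
  (forall j k, (k <= x_order)%N -> u (Shv j k) = w (Shv j k)) ->
  xint i u = xint i w.
Proof.
move=> hc uw; have rE j k : (k < x_order)%N -> ratio j k u = ratio j k w.
  by move=> kc; rewrite /ratio !uw// ltnW.
move: hc rE; rewrite !inE /x_order /xint /xint_pol.
by move=> /or3P[] /eqP -> /= rE; elim/ord2P: i => /=; rewrite !rE.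
Qed.

Lemma xint_integral i : c \in [:: 1; 2; 3]%N ->
  x_integral g 0 x_order%:Z (xint i).
Proof.
move=> hc; have [exint Dxint] := is_Dx_xint i hc; split=> // [|u w uw].
  exact: exppoly_smooth.
apply: eq_xint => // j k kc; apply: uw; right; exists j, k%:Z; split=> //.
Qed.

(** Fits the last monomial of an x-integral, the inverse of a ratio, which is the only one to
    contain the highest shift of its own field. *)
Lemma partial_expR_lin h v u (a b : R) :
  (forall t, h (dfwith u v t) = a + expR (b - t)) ->
  partial v h u = - expR (b - u v).
Proof.
move=> hE; apply: partial_is_derive; rewrite (funext hE).
have d1 : is_derive (u v) 1 (cst b - id) (0 - 1 : R) by exact: is_deriveB.
have d2 := @is_derive1_comp R expR (cst b - id) (u v) _ _
  (is_derive_expR (b - u v)) d1.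
have := is_deriveD (is_derive_cst a (u v) 1) d2.
by rewrite add0r sub0r mulrN1.
Qed.

Lemma dfwith_Shv u j (m : int) t i (n : int) : dfwith u (Shv j m) t (Shv i n) =
  if (j == i) && (m == n) then t else u (Shv i n).
Proof.
case: ifPn => [/andP[/eqP <- /eqP <-]|jm]; first exact: dfwithin.
by rewrite dfwithout//; apply/eqP => -[jk mn]; move: jm; rewrite jk mn !eqxx.
Qed.

Lemma partial_xint_diag j u : c \in [:: 1; 2; 3]%N ->
  partial (Shv j x_order) (xint j) u =
  - expR (u (Shv j x_order.-1) - u (Shv j x_order)).
Proof.
(* [a] is the sum of all monomials but the last. *)
move=> hc; pose a := xint j u - expR (u (Shv j x_order.-1) - u (Shv j x_order)).
apply: (@partial_expR_lin _ _ _ a) => t; rewrite {}/a.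
move: hc; rewrite !inE /x_order /xint /xint_pol.
move=> /or3P[] /eqP ->; elim/ord2P: j; rewrite /ratio/= !dfwith_Shv/=
  -!expRN !opprB; ring.
Qed.

(** The second integral contains no X_k with k = [x_order.-1], so the Jacobian of the x-integrals is
    triangular. *)
Lemma partial_xint10 u : c \in [:: 1; 2; 3]%N ->
  partial (Shv 0 x_order) (xint 1) u = 0.
Proof.
move=> hc; apply: partial_affine => t; rewrite mul0r addr0.
move: hc; rewrite !inE /x_order /xint /xint_pol.
by move=> /or3P[] /eqP -> /=; rewrite /ratio/= !dfwith_Shv/=.
Qed.

Lemma det_xint u : c \in [:: 1; 2; 3]%N ->
  \det (\matrix_(i < 2, j < 2) partial (Shv j x_order) (xint i) u) != 0.
Proof.
move=> hc; rewrite det2 !mxE !partial_xint_diag// partial_xint10// mulr0 subr0.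
by rewrite mulrNN mulf_neq0// lt0r_neq0// expR_gt0.
Qed.

End XIntegrals.

Theorem mainTheorem1 (R : realType) (c : nat) (hc : c \in [:: 1; 2; 3]%N) :
  Darboux_integrable (@exp_rhs R c).
Proof.
(* T itself has order 2, as it contains the derivatives of p = r^1_[1] and q = r^2_[1]; [T_order c]
   further derivatives are taken. *)
exists (x_order c), (T_order c).+2, (xint c), (nint c (T_order c)).
by split=> [i|i|u|u]; [exact: xint_integral|exact: nint_integral
  |exact: det_xint|exact: det_nint].
Qed.
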